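(* Let $G=(V,E)$ be a directed acyclic graph with $V=\{1,\dots,m\}$. If every connected component of the complement graph $G^c$ contains an odd cycle, then the model $\mathcal{N}_*(G)$ is generically finitely identifiable.
   Context: Let $G=(V,E)$ be a directed acyclic graph (DAG) with $V=\{1,\dots,m\}$, labelled in topological order, i.e. $w\to v\in E$ (also written $(w,v)\in E$) only if $w<v$. Let $\mathbb{R}_E=\{\Lambda=(\lambda_{wv})\in\mathbb{R}^{m\times m}: w\to v\notin E\Rightarrow \lambda_{wv}=0\}$, let $\mathrm{diag}_m^+$ be the set of $m\times m$ diagonal matrices with positive diagonal, and let $\Theta=\mathbb{R}_E\times \mathrm{diag}_m^+\times\mathbb{R}^m$, regarded as an open subset of $\mathbb{R}^{2m+|E|}$. The model $\mathcal{N}_*(G)$ is the family of normal distributions $N_m(0,\Sigma)$ with $\Sigma$ in the image of the parametrization map $$\phi_G:\Theta\to\mathbb{R}^{m\times m},\qquad \phi_G(\Lambda,\Omega,\delta)=(I_m-\Lambda^T)^{-1}(\Omega+\delta\delta^T)(I_m-\Lambda)^{-1}.$$ An algebraic set in $\mathbb{R}^n$ is the common zero set of finitely many real polynomials; it is proper if it is not all of $\mathbb{R}^n$. A map $f$ defined on an open set $S\subset\mathbb{R}^n$ is generically finite-to-one if there is a proper algebraic set $\tilde S\subset\mathbb{R}^n$ such that for every $s\in S\setminus\tilde S$ the fiber $\{s'\in S: f(s')=f(s)\}$ is finite. The model $\mathcal{N}_*(G)$ is generically finitely identifiable if $\phi_G$ is generically finite-to-one on $\Theta$. The complement $G^c=(V,E^c)$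 is the undirected graph on $V$ in which distinct nodes $v,w$ are adjacent iff $(v,w)\notin E$ and $(w,v)\notin E$. Isolated nodes count as connected components (containing no odd cycle). *)

(* Defs.v *)
From HB Require Import structures.
From mathcomp Require Import all_boot all_order all_algebra.
From mathcomp Require Import classical_sets cardinality reals.
From mathcomp Require Import mpoly.
Set Implicit Arguments.
Unset Strict Implicit.
Unset Printing Implicit Defensive.
Import Order.TTheory GRing.Theory Num.Theory.
Local Open Scope classical_set_scope.
Local Open Scope ring_scope.

(* A directed graph on m nodes is a relation [E : rel 'I_m], with [E w v] for
   the edge w -> v; the nodes 1, ..., m are numbered 0, ..., m - 1. *)

Definition topologically_ordered m (E : rel 'I_m) : Prop :=
  forall w v : 'I_m, E w v -> (w < v)%N.

(* A topological order leaves no directed cycle, so acyclicity need not be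
   assumed separately. *)
Lemma topologically_ordered_acyclic m (E : rel 'I_m) :
  topologically_ordered E -> forall c : seq 'I_m, cycle E c -> c = [::].
Proof.
move=> EP [//|x c] xcx.
have : path (relpre val ltn) x (rcons c x).
  by apply: sub_path xcx => w v /EP.
rewrite path_sortedE; last by move=> a b d /=; apply: ltn_trans.
by rewrite all_rcons /= ltnn.
Qed.

Definition complement_graph m (E : rel 'I_m) : rel 'I_m :=
  fun v w => [&& v != w, ~~ E v w & ~~ E w v].

Definition components (T : finType) (e : rel T) : {set {set T}} :=
  equivalence_partition (connect e) [set: T]%SET.

(* A cycle of an undirected graph visits at least three nodes, once each; the
   library's [cycle] also accepts [:: x; y] as soon as x and y are adjacent. *)
Definition odd_cycle (T : eqType) (e : rel T) (c : seq T) : Prop :=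
  [/\ cycle e c, uniq c, (2 < size c)%N & odd (size c)].

Definition contains_odd_cycle (T : finType) (e : rel T) (C : {set T}) : Prop :=
  exists c : seq T, odd_cycle e c /\ {subset c <= C}.

Section AlgebraicSets.
Variables (R : realType) (n : nat).

Definition zero_locus (ps : seq {mpoly R[n]}) : set 'rV[R]_n :=
  [set x | forall p, p \in ps -> p.@[fun i => x 0 i] = 0].

Definition algebraic_set (A : set 'rV[R]_n) : Prop :=
  exists ps : seq {mpoly R[n]}, A = zero_locus ps.

(* The domain S is meant to be open. *)
Definition generically_finite_to_one (U : Type)
    (S : set 'rV[R]_n) (f : 'rV[R]_n -> U) : Prop :=
  exists A : set 'rV[R]_n,
    [/\ algebraic_set A, A <> setT &
        forall s, S s -> ~ A s -> finite_set [set s' | S s' /\ f s' = f s]].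

End AlgebraicSets.

Section Model.
Variables (R : realType) (m : nat) (E : rel 'I_m).

Definition edges : {set 'I_m * 'I_m} := [set e | E e.1 e.2]%SET.

Definition edge_matrices : set 'M[R]_m :=
  [set L | forall w v, ~~ E w v -> L w v = 0].

Definition pos_diag_matrices : set 'M[R]_m :=
  [set W | is_diag_mx W /\ forall i, 0 < W i i].

(* The triples (Lambda, Omega, delta). *)
Definition parameter : Type := ('M[R]_m * 'M[R]_m * 'cV[R]_m)%type.

Definition Theta : set parameter :=
  [set t | edge_matrices t.1.1 /\ pos_diag_matrices t.1.2].

(* [invmx] is a genuine inverse here when E is topologically ordered, as
   I - Lambda is then unitriangular for Lambda in [edge_matrices]. *)
Definition phi (t : parameter) : 'M[R]_m :=
  let: (L, W, d) := t in
  invmx (1%:M - L^T) *m (W + d *m d^T) *m invmx (1%:M - L).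

(* The coordinates on R_E x diag_m x R^m: the entries of Lambda along the edges,
   then the diagonal of Omega, then delta. *)
Definition dim_Theta : nat := (#|edges| + (m + m))%N.

Definition of_coords (x : 'rV[R]_dim_Theta) : parameter :=
  (\sum_(k < #|edges|)
      lsubmx x 0 k *: delta_mx (enum_val k).1 (enum_val k).2,
   diag_mx (lsubmx (rsubmx x)),
   (rsubmx (rsubmx x))^T).

(* Theta regarded as a subset of R^(2m + |E|). *)
Definition Theta_coords : set 'rV[R]_dim_Theta := of_coords @^-1` Theta.

Definition generically_finitely_identifiable : Prop :=
  generically_finite_to_one Theta_coords (phi \o of_coords).

Lemma of_coords_edge (x : 'rV[R]_dim_Theta) (k : 'I_#|edges|) :
  (of_coords x).1.1 (enum_val k).1 (enum_val k).2 = lsubmx x 0 k.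
Proof.
rewrite /= summxE (bigD1 k) //= big1 => [|l lk].
  by rewrite !mxE !eqxx addr0 mulr1.
rewrite !mxE -xpair_eqE -!surjective_pairing (inj_eq enum_val_inj).
by rewrite eq_sym (negPf lk) mulr0.
Qed.

Lemma of_coords_edge_matrices (x : 'rV[R]_dim_Theta) :
  edge_matrices (of_coords x).1.1.
Proof.
move=> w v nE; rewrite /= summxE big1 // => k _; rewrite !mxE.
case: eqP => [wk|_]; last by rewrite mulr0.
case: eqP => [vk|_]; last by rewrite mulr0.
by have := enum_valP k; rewrite inE -wk -vk (negPf nE).
Qed.

Lemma of_coords_inj : injective of_coords.
Proof.
move=> x y exy.
have el : lsubmx x = lsubmx y.
  by apply/rowP => k; rewrite -!of_coords_edge exy.
case: exy => _ /matrixP eW /trmx_inj ed.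
have ew : lsubmx (rsubmx x) = lsubmx (rsubmx y).
  by apply/rowP => i; have := eW i i; rewrite !mxE eqxx !mulr1n.
have er : rsubmx x = rsubmx y.
  by rewrite -(hsubmxK (rsubmx x)) ew ed hsubmxK.
by rewrite -(hsubmxK x) el er hsubmxK.
Qed.

Lemma range_of_coords :
  range of_coords = [set t | edge_matrices t.1.1 /\ is_diag_mx t.1.2].
Proof.
apply/seteqP; split=> [t [x _ <-]|[[L W] d] /= [LE Wd]].
  by split; [apply: of_coords_edge_matrices | apply: diag_mx_is_diag].
exists (row_mx (\row_k L (enum_val k).1 (enum_val k).2)
          (row_mx (\row_i W i i) d^T)) => //.
rewrite /of_coords !row_mxKl !row_mxKr row_mxKl trmxK; congr (_, _, _).
  have := of_coords_edge (row_mx (\row_k L (enum_val k).1 (enum_val k).2)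
          (row_mx (\row_i W i i) d^T)).
  have := of_coords_edge_matrices (row_mx
          (\row_k L (enum_val k).1 (enum_val k).2)
          (row_mx (\row_i W i i) d^T)).
  rewrite /of_coords /= row_mxKl => off on; apply/matrixP => w v.
  have [Ewv|nE] := boolP (E w v); last by rewrite off // LE.
  have wvE : (w, v) \in edges by rewrite inE.
  by have := on (enum_rank_in wvE (w, v)); rewrite !mxE enum_rankK_in.
apply/matrixP => i j; rewrite !mxE; case: eqP => [->|/eqP ij].
  by rewrite mulr1n.
by rewrite mulr0n; move/is_diag_mxP: Wd => ->.
Qed.

Lemma unitmx_edge_matrix (L : 'M[R]_m) :
  topologically_ordered E -> edge_matrices L -> 1%:M - L \in unitmx.
Proof.
move=> EP LE.
have L0 (i j : 'I_m) : (j <= i)%N -> L i j = 0.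
  by move=> ji; apply: LE; apply/negP => /EP; rewrite ltnNge ji.
rewrite -unitmx_tr unitmxE det_trig.
  by rewrite big1 ?unitr1 // => i _; rewrite !mxE eqxx L0 // subr0.
apply/is_trig_mxP => i j ij; rewrite !mxE L0 ?(ltnW ij) // subr0.
by rewrite -val_eqE /= gtn_eqF.
Qed.

End Model.

(* Main.v *)
Require Import Defs.
From HB Require Import structures.
From mathcomp Require Import all_boot all_order all_algebra.
From mathcomp Require Import boolp classical_sets cardinality reals.
From mathcomp Require Import mpoly lra.
Set Implicit Arguments.
Unset Strict Implicit.
Unset Printing Implicit Defensive.
Import Order.TTheory GRing.Theory Num.Theory.
Local Open Scope ring_scope.

(** The covariance matrix of the model has polynomial entries in the
    coordinates of the parameter space: I - Lambda is unitriangular, so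
    it is invertible already over the polynomial ring.  The theorem then rests
    on two facts.

    The first is a Jacobian criterion, [generic_finite_fibers]: a polynomial map
    on R^n whose differential is injective at a single point has generically
    finite fibers.  After composing with a linear left inverse of that
    differential one may assume that there are exactly n polynomials g, whose
    Jacobian determinant is not the zero polynomial.  For each coordinate x_i,
    the n + 1 polynomials x_i, g_1, ..., g_n in n variables are algebraically
    dependent ([mpoly_algebraic_dependence], a dimension count).  A relation
    Q (x_i, g) = 0 can be differentiated along every x_k; as the Jacobian matrix
    is invertible over the field of fractions, one may pass from Q to a partial
    derivative of Q until the derivative of Q in its first variable does not
    vanish at (x_i, g) ([separable_relation]).  Wherever that derivative is
    nonzero at a point x, the univariate polynomial Q (T, g x) is nonzero, and
    the i-th coordinate of every point in the fiber through x is one of its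
    roots.  This bounds the whole fiber, including its points where the
    derivative vanishes, and the exceptional set is the zero locus of a single
    nonzero polynomial.

    The second is that the differential of the parametrization is injective at
    Lambda = 0, Omega = I, delta = (1, ..., 1) ([differential_cov_inj]).  For a
    tangent vector (L, W, d) in its kernel, put y_i = d_i + sum_u L_ui.  Then
      L_ij + L_ji + W_ij + y_i + y_j = 0  for all i and j,
    and so y_i + y_j = 0 whenever i and j are adjacent in the complement graph.
    Going once around an odd cycle turns y_i into - y_i, which kills y on the
    component of the cycle, hence everywhere.  At most one of L_ij and L_ji can
    be nonzero because the graph is acyclic, so that L, W and finally d vanish
    as well. *)

(** * Derivatives of multivariate polynomials *)

(** Stated for an arbitrary derivation [D], so that it covers both the partial
    derivatives of multivariate polynomials and the derivative of univariate
    ones. *)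
Lemma mmap_chain_rule (R A : comNzRingType) (n : nat) (f : {rmorphism R -> A})
    (h : 'I_n -> A) (D : {additive A -> A})
    (DM : forall a b, D (a * b) = D a * b + a * D b)
    (Df : forall c, D (f c) = 0) (p : {mpoly R[n]}) :
  D (mmap f h p) = \sum_j mmap f h p^`M(j) * D (h j).
Proof.
pose good (q : {mpoly R[n]}) :=
  D (mmap f h q) = \sum_j mmap f h q^`M(j) * D (h j).
have goodC c : good c%:MP.
  rewrite /good mmapC Df big1 // => j _.
  by rewrite mderivC raddf0 mul0r.
have goodD q r : good q -> good r -> good (q + r).
  rewrite /good !raddfD /= => -> ->; rewrite -big_split; apply: eq_bigr => j _.
  by rewrite mderivD raddfD mulrDl.
have goodM q r : good q -> good r -> good (q * r).
  have mM := mmap_is_multiplicative h f; rewrite /good (mM.1 q r) DM => -> ->.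
  rewrite mulr_suml mulr_sumr -big_split /=.
  apply: eq_bigr => j _; rewrite mderivM raddfD /= !mM.1 mulrDl /=.
  by rewrite mulrAC !mulrA.
have goodX j : good 'X_j.
  rewrite /good mmapX mmap1U (bigD1 j) //= big1 => [|k kj].
    have UU : (U_(j) - U_(j) = 0)%MM by rewrite -{1}[U_(j)%MM]add0m addmK.
    by rewrite mderivX mnm1E eqxx UU mpolyX0 scale1r rmorph1 mul1r addr0.
  by rewrite mderivX mnm1E eq_sym (negPf kj) scale0r raddf0 mul0r.
elim/mpolyind: p => [|c m p _ _ gp]; first exact: (goodC 0).
apply: (goodD _ _ _ gp); rewrite -mul_mpolyC; apply: (goodM _ _ (goodC c)).
rewrite mpolyXE_id; apply: (big_ind good) => [|q r|i _].
- exact: (goodC 1).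
- exact: goodM.
by elim: (m i) => [|k IH]; [apply: (goodC 1) | rewrite exprS; apply: goodM].
Qed.

Lemma msize_mderiv_lt (R : nzRingType) (n : nat) (j : 'I_n)
    (p : {mpoly R[n]}) :
  p != 0 -> (msize p^`M(j) < msize p)%N.
Proof.
move=> p0; have sp : (0 < msize p)%N by rewrite lt0n msize_poly_eq0.
rewrite -(ltn_predK sp) ltnS msizeE; apply/bigmax_leqP_seq => m mp _.
rewrite -ltnS (ltn_predK sp) -[(mdeg m).+1]addn1 -(mdeg1 j) -mdegD.
apply: msize_mdeg_lt.
rewrite mcoeff_msupp; apply: contraTneq mp => pm.
by rewrite mcoeff_msupp mcoeff_mderiv pm mul0rn eqxx.
Qed.

Lemma mderiv_eq0_const (R : numDomainType) (n : nat) (p : {mpoly R[n]}) :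
  (forall j, p^`M(j) = 0) -> p = (p@_0)%:MP.
Proof.
move=> dp; apply/mpolyP => m; rewrite mcoeffC.
have [->|m0] := eqVneq m 0%MM; first by rewrite mulr1.
have [j mj] : exists j, m j != 0%N.
  apply/existsP; apply: contraNT m0 => /existsPn m0; apply/eqP/mnmP => i.
  by rewrite mnm0E; apply/eqP; rewrite -[_ == _]negbK.
have jm : (U_(j) <= m)%MM by rewrite lep1mP.
have /eqP := congr1 (mcoeff (m - U_(j))%MM) (dp j).
by rewrite mcoeff_mderiv submK // mcoeff0 mulrn_eq0 /= mulr0 => /eqP.
Qed.

(** In characteristic 0 a nonconstant polynomial has a nonzero partial
    derivative, which has smaller degree: every nonzero polynomial is thus
    reached from a nonzero constant. *)
Lemma mpoly_deriv_ind (R : numDomainType) (n : nat)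
    (P : {mpoly R[n]} -> Prop) :
  (forall c, c != 0 -> P c%:MP) ->
  (forall p j, p != 0 -> p^`M(j) != 0 -> P p^`M(j) -> P p) ->
  forall p, p != 0 -> P p.
Proof.
move=> PC Pd p; have [k] := ubnP (msize p); elim: k p => // k IH p pk p0.
have [/forallP dp|/forallPn [j dj]] := boolP [forall j, p^`M(j) == 0].
  have pE := mderiv_eq0_const (fun j => eqP (dp j)).
  by rewrite pE; apply: PC; apply: contraNneq p0 => p00; rewrite pE p00 raddf0.
apply: (Pd _ j) => //; apply: IH => //.
exact: leq_trans (msize_mderiv_lt j p0) pk.
Qed.

(** If [p] vanishes identically, then so do its restrictions to the lines
    parallel to an axis, hence the derivatives of these restrictions, hence the
    partial derivatives of [p]. *)
Lemma mpoly_nonvanishing (R : numFieldType) (n : nat) (p : {mpoly R[n]}) :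
  p != 0 -> exists x : 'I_n -> R, p.@[x] != 0.
Proof.
move: p; apply: mpoly_deriv_ind => [c c0|p j p0 _ [x px]].
  by exists (fun=> 0); rewrite mevalC.
have [[t pt]|/forallNP pline] := pselect (exists t,
    p.@[fun i => x i + t *+ (i == j)] != 0).
  by eexists; apply: pt.
have h (t : R) : p.@[fun i => x i + t *+ (i == j)] = 0.
  by apply/eqP; rewrite -[_ == _]negbK; apply/negP/pline.
pose L i : {poly R} := (x i)%:P + 'X *+ (i == j).
have mapL (q : {mpoly R[n]}) t :
    (mmap polyC L q).[t] = q.@[fun i => x i + t *+ (i == j)].
  rewrite /meval /mmap horner_sum; apply: eq_bigr => m _.
  rewrite hornerM hornerC horner_prod; congr (_ * _); apply: eq_bigr => i _.
  by rewrite horner_exp hornerD hornerC hornerMn hornerX.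
have q0 : mmap polyC L p = 0.
  apply/eqP; apply/negPn/negP => q0.
  pose rs : seq R := [seq i%:R | i <- iota 0 (size (mmap polyC L p))].
  have : (size rs < size (mmap polyC L p))%N; last first.
    by rewrite size_map size_iota ltnn.
  apply: max_poly_roots => //.
    by apply/allP => t _; rewrite rootE mapL h.
  by rewrite map_inj_uniq ?iota_uniq //; apply: mulrIn; rewrite oner_eq0.
have := mmap_chain_rule L (D := @deriv R) (@derivM _) (@derivC _) p.
rewrite q0 /= deriv0 (bigD1 j) //= big1 => [|i /negPf ij]; last first.
  by rewrite /L ij derivD derivC mulr0n add0r deriv0 mulr0.
have -> : (L j)^`() = 1 by rewrite /L eqxx derivD derivC derivX add0r.
rewrite addr0 mulr1.
move/(congr1 (horner^~ 0)); rewrite horner0 mapL => /esym pj0.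
case/eqP: px; rewrite -[RHS]pj0; apply: meval_eq => i.
by rewrite mul0rn addr0.
Qed.

(** * Algebraic dependence *)

Lemma msizeM_leS (F : idomainType) (n k l : nat) (p q : {mpoly F[n]}) :
  (msize p <= k.+1)%N -> (msize q <= l.+1)%N -> (msize (p * q) <= (k + l).+1)%N.
Proof.
move=> pk ql; have [->|p0] := eqVneq p 0; first by rewrite mul0r msize0.
have [->|q0] := eqVneq q 0; first by rewrite mulr0 msize0.
by rewrite msizeM // -ltnS prednK; [rewrite -addnS -addSn leq_add |
  rewrite addn_gt0 lt0n msize_poly_eq0 p0].
Qed.

Lemma lker_row_neq0 (F : fieldType) (m n : nat) (A : 'M[F]_(m, n)) :
  (n < m)%N -> exists2 u : 'rV_m, u != 0 & u *m A = 0.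
Proof.
move=> nm; have : kermx A != 0.
  by rewrite -mxrank_eq0 mxrank_ker subn_eq0 -ltnNge
    (leq_ltn_trans (rank_leq_col A)).
by case/rowV0Pn => u /sub_kermxP uA u0; exists u.
Qed.

(** There are D^(n+1) monomials in n + 1 variables with exponents below D.  Once
    the [h i] are substituted, they become polynomials in n variables of degree
    at most (n + 1) d D, if every [h i] has degree at most d; these have at most
    ((n + 1) d D + 1)^n coefficients.  For D large there are fewer coefficients
    than monomials, which forces a linear relation. *)
Lemma mpoly_algebraic_dependence (F : fieldType) (n : nat)
    (h : 'I_n.+1 -> {mpoly F[n]}) :
  exists2 P : {mpoly F[n.+1]}, P != 0 & mmap (@mpolyC n F) h P = 0.
Proof.
pose d := (\sum_i msize (h i))%N.
have hd i : (msize (h i) <= d.+1)%N.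
  by rewrite /d (bigD1 i) //= -addnS leq_addr.
(* K <= C * D, so that K ^ n <= C ^ n * D ^ n < D ^ n.+1 *)
pose C := (n.+1 * d).+1; pose D := (C ^ n).+1; pose K := (n.+1 * d * D).+1.
pose mono k N (a : {ffun 'I_k -> 'I_N}) : 'X_{1..k} :=
  [multinom (a i : nat) | i < k].
have mono_inj k N : injective (@mono k N).
  move=> a b /mnmP ab; apply/ffunP => i; apply: val_inj.
  by have := ab i; rewrite !mnmE.
pose dom := {ffun 'I_n.+1 -> 'I_D}; pose cod := {ffun 'I_n -> 'I_K}.
pose A : 'M[F]_(#|{: dom}|, #|{: cod}|) := \matrix_(i, j)
  (mmap1 h (mono _ _ (enum_val i)))@_(mono _ _ (enum_val j)).
have card_lt : (#|{: cod}| < #|{: dom}|)%N.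
  rewrite !card_ffun !card_ord (@leq_ltn_trans ((C * D) ^ n)%N) //.
    have KCD : (K <= C * D)%N.
      by rewrite /K /C (mulSn (n.+1 * d)) -add1n leq_add2r.
    by case: (n) => // k; rewrite leq_exp2r.
  by rewrite expnMn expnS ltn_pmul2r // expn_gt0.
have [u u0 uA] := lker_row_neq0 A card_lt.
exists (\sum_i u 0 i *: 'X_[mono _ _ (enum_val i)]).
  apply: contraNneq u0 => P0; apply/eqP/rowP => i; rewrite mxE.
  have := congr1 (mcoeff (mono _ _ (enum_val i))) P0.
  rewrite mcoeff0 raddf_sum (bigD1 i) //= big1 => [|k ki].
    by rewrite mcoeffZ mcoeffX eqxx mulr1 addr0.
  by rewrite mcoeffZ mcoeffX (inj_eq (@mono_inj _ _)) (inj_eq enum_val_inj)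
    (negPf ki) mulr0.
rewrite raddf_sum /=.
under eq_bigr do rewrite mmapZ mmapX mul_mpolyC.
have size_mono (a : dom) : (msize (mmap1 h (mono _ _ a)) <= K)%N.
  have pow i k : (msize (h i ^+ k) <= (k * d).+1)%N.
    elim: k => [|k IH]; first by rewrite expr0 msize1.
    by rewrite exprS mulSn msizeM_leS.
  have -> : K = (\sum_(i < n.+1) d * D).+1.
    by rewrite sum_nat_const card_ord mulnA.
  apply: (big_ind2 (fun q k => msize q <= k.+1)%N) => [|????|i _].
  - by rewrite msize1.
  - exact: msizeM_leS.
  - by rewrite mnmE (leq_trans (pow _ _)) // ltnS mulnC leq_mul2l ltnW ?orbT.
apply/mpolyP => m; rewrite raddf_sum mcoeff0 /=.
(* a monomial outside the box of [A] has degree at least K *)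
have [mK|/forallPn [i mi]] := boolP [forall i, (m i < K)%N].
  pose a : cod := [ffun i => Ordinal (forallP mK i)].
  have -> : m = mono _ _ (enum_val (enum_rank a)).
    by rewrite enum_rankK; apply/mnmP => i; rewrite mnmE ffunE.
  have /rowP/(_ (enum_rank a)) := uA; rewrite !mxE => uAm; rewrite -[RHS]uAm.
  by apply: eq_bigr => i _; rewrite mcoeffZ mxE.
apply: big1 => k _; rewrite mcoeffZ memN_msupp_eq0 ?mulr0 //.
apply: msize_mdeg_ge; apply: leq_trans (size_mono _) _.
rewrite -leqNgt in mi; apply: leq_trans mi _.
by rewrite mdegE (bigD1 i) //= leq_addr.
Qed.

(** * The Jacobian criterion for finite fibers *)

Lemma mulmx_eq0_det (A : idomainType) (n : nat) (J : 'M[A]_n) (u : 'rV_n) :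
  \det J != 0 -> u *m J = 0 -> u = 0.
Proof.
move=> dJ uJ; have : u *m J *m \adj J = \det J *: u.
  by rewrite -mulmxA mul_mx_adj mul_mx_scalar.
rewrite uJ mul0mx => /rowP h; apply/rowP => i; have /esym/eqP := h i.
by rewrite !mxE mulf_eq0 (negPf dJ) => /eqP.
Qed.

Section JacobianCriterion.
Variables (R : numFieldType) (n : nat).

Definition jacobian (g : 'I_n -> {mpoly R[n]}) : 'M[{mpoly R[n]}]_n :=
  \matrix_(j, k) (g j)^`M(k).

Definition adjoin_coord (A : Type) (t : A) (g : 'I_n -> A) (j : 'I_n.+1) : A :=
  if unlift ord0 j is Some k then g k else t.

(** Start from any nonzero relation [P].  If the derivative of [P] in the
    variable that stands for [x_i] vanishes at [(x_i, g)], then the chain rule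
    puts the vector of the other derivatives of [P] at [(x_i, g)] in the kernel
    of the Jacobian matrix of [g].  All the partial derivatives of [P] are then
    relations too, and one of them is a nonzero relation of smaller degree. *)
Lemma separable_relation (g : 'I_n -> {mpoly R[n]}) (i : 'I_n) :
  \det (jacobian g) != 0 ->
  exists2 Q : {mpoly R[n.+1]},
    mmap (@mpolyC n R) (adjoin_coord 'X_i g) Q = 0 &
    mmap (@mpolyC n R) (adjoin_coord 'X_i g) Q^`M(ord0) != 0.
Proof.
move=> dJ; set h := adjoin_coord _ _.
have [P P0 Ph] := mpoly_algebraic_dependence h.
move: P P0 Ph; apply: mpoly_deriv_ind => [c c0|P j P0 Pj IH Ph].
  by rewrite mmapC => /eqP; rewrite mpolyC_eq0 (negPf c0).
have [PT|PT] := eqVneq (mmap (@mpolyC n R) h P^`M(ord0)) 0; last by exists P.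
apply: IH; case: (unliftP ord0 j) => [k|] -> //.
pose u : 'rV_n := \row_l mmap (@mpolyC n R) h P^`M(lift ord0 l).
suff /rowP/(_ k) : u = 0 by rewrite !mxE.
apply: (mulmx_eq0_det dJ); apply/rowP => l; rewrite !mxE.
have := mmap_chain_rule h (D := @mderiv n R l) (@mderivM _ _ l)
  (@mderivC _ _ l) P.
rewrite Ph /= mderiv0 big_ord_recl PT mul0r add0r => PE; rewrite [RHS]PE.
by apply: eq_bigr => r _; rewrite !mxE /h /adjoin_coord liftK.
Qed.

Lemma poly_roots_seq (p : {poly R}) :
  p != 0 -> exists r : seq R, forall x, root p x -> x \in r.
Proof.
have [k] := ubnP (size p); elim: k p => // k IH p pk p0.
have [[x px]|/forallNP nr] := pselect (exists x, root p x); last first.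
  by exists [::] => x px; case: (nr x).
have /factor_theorem [q pE] := px.
have q0 : q != 0 by apply: contraNneq p0 => q0; rewrite pE q0 mul0r.
have [|r rq] := IH q _ q0.
  by rewrite pE size_Mmonic ?monicXsubC // size_XsubC addn2 // ltnS in pk.
exists (x :: r) => y; rewrite pE rootM root_XsubC inE => /orP[/rq ->|->//].
by rewrite orbT.
Qed.

Lemma finite_box (r : 'I_n -> seq R) :
  finite_set [set x : 'rV[R]_n | forall i, x 0 i \in r i].
Proof.
pose N := (\max_i size (r i))%N.
pose f (a : {ffun 'I_n -> 'I_N}) : 'rV[R]_n := \row_i (r i)`_(a i).
apply: (@sub_finite_set _ _ (f @` setT)%classic);
  last exact/finite_image/finite_finset.
move=> x /= xr.
have lt i : (index (x 0%R i) (r i) < N)%N.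
  by rewrite (@leq_trans (size (r i))) ?index_mem ?xr //
    /N (bigD1 i) //= leq_maxl.
exists [ffun i => Ordinal (lt i)] => //.
by apply/rowP => i; rewrite mxE ffunE /= nth_index ?xr.
Qed.

(** The polynomial [c] is the product over [i] of the derivatives given by
    [separable_relation].  Where it does not vanish, the separable relation for
    the i-th coordinate specializes to a nonzero univariate polynomial [q i]
    that depends on the value of [g] only. *)
Lemma generic_finite_fibers_square (g : 'I_n -> {mpoly R[n]}) :
  \det (jacobian g) != 0 ->
  exists2 c : {mpoly R[n]}, c != 0 & forall x : 'rV[R]_n,
    c.@[fun i => x 0 i] != 0 ->
    finite_set [set y : 'rV[R]_n | forall j,
      (g j).@[fun i => y 0 i] = (g j).@[fun i => x 0 i]].
Proof.
move=> dJ; have /choice [Q QP] : forall i, exists Q : {mpoly R[n.+1]},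
    mmap (@mpolyC n R) (adjoin_coord 'X_i g) Q = 0 /\
    mmap (@mpolyC n R) (adjoin_coord 'X_i g) Q^`M(ord0) != 0.
  by move=> i; have [Q] := separable_relation i dJ; exists Q.
exists (\prod_i mmap (@mpolyC n R) (adjoin_coord 'X_i g) (Q i)^`M(ord0)).
  by apply/prodf_neq0 => i _; case: (QP i).
move=> x; rewrite rmorph_prod /= => /prodf_neq0 cx.
pose gx k := (g k).@[fun i => x 0 i].
pose L : 'I_n.+1 -> {poly R} := adjoin_coord 'X (fun k => (gx k)%:P).
pose q i := mmap polyC L (Q i).
(* on the fiber through [x], the value of [q i] at [y 0 i] is that of the
   relation [Q i] at [y] *)
have mapL (p : {mpoly R[n.+1]}) (i : 'I_n) (y : 'rV[R]_n) :
    (forall k, (g k).@[fun i => y 0 i] = gx k) ->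
    (mmap polyC L p).[y 0 i] =
    (mmap (@mpolyC n R) (adjoin_coord 'X_i g) p).@[fun i => y 0 i].
  move=> gy; rewrite /mmap horner_sum raddf_sum; apply: eq_bigr => m _.
  rewrite hornerM hornerC /= mevalM mevalC horner_prod rmorph_prod /=.
  congr (_ * _); apply: eq_bigr => k _; rewrite horner_exp rmorphXn /=.
  congr (_ ^+ _); rewrite /L /adjoin_coord; case: unliftP => [l|] _.
    by rewrite hornerC gy.
  by rewrite hornerX mevalXU.
have q0 i : q i != 0.
  have := mmap_chain_rule L (D := @deriv R) (@derivM _) (@derivC _) (Q i).
  rewrite big_ord_recl big1 => [|k _]; last first.
    by rewrite /= /L /adjoin_coord liftK derivC mulr0.
  have -> : L ord0 = 'X by rewrite /L /adjoin_coord unlift_none.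
  rewrite addr0 /= derivX mulr1.
  move/(congr1 (horner^~ (x 0 i))); rewrite mapL // => dq.
  by apply: contra_neq (cx i isT) => q0; rewrite -dq -/(q i) q0 deriv0 horner0.
have /choice [r rP] : forall i, exists r : seq R,
    forall t, root (q i) t -> t \in r.
  by move=> i; apply: poly_roots_seq.
apply: sub_finite_set (finite_box r) => y gy i.
by apply: rP; rewrite rootE mapL // (QP i).1 meval0.
Qed.

(** A left inverse [B] of the differential at [x0] combines the polynomials [f]
    into a square system [g] with Jacobian determinant 1 at [x0].  The fibers of
    [f] lie in those of [g]. *)
Lemma generic_finite_fibers (I : finType) (f : I -> {mpoly R[n]})
    (x0 : 'rV[R]_n) :
  (forall v : 'rV[R]_n, (forall a,
     \sum_k v 0 k * ((f a)^`M(k)).@[fun i => x0 0 i] = 0) -> v = 0) ->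
  exists2 c : {mpoly R[n]}, c != 0 & forall x : 'rV[R]_n,
    c.@[fun i => x 0 i] != 0 ->
    finite_set [set y : 'rV[R]_n | forall a,
      (f a).@[fun i => y 0 i] = (f a).@[fun i => x 0 i]].
Proof.
move=> injf.
pose J : 'M[R]_(n, #|I|) :=
  \matrix_(k, a) ((f (enum_val a))^`M(k)).@[fun i => x0 0 i].
have freeJ : row_free J.
  rewrite -kermx_eq0; apply: contraT => /rowV0Pn [v /sub_kermxP vJ].
  case/eqP; apply: injf => a; have /rowP/(_ (enum_rank a)) := vJ; rewrite !mxE.
  by under eq_bigr do rewrite mxE enum_rankK.
pose B := pinvmx J; have JB : J *m B = 1%:M := mulmxVp freeJ.
pose g l := \sum_a (B a l)%:MP * f (enum_val a).
have [|c c0 cP] := @generic_finite_fibers_square g.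
  suff dJ : (\det (jacobian g)).@[fun i => x0 0 i] = 1.
    by apply: contra_eq_neq dJ => ->; rewrite meval0 eq_sym oner_eq0.
  rewrite -det_map_mx -(det1 R n) -JB -[RHS]det_tr; congr (\det _).
  apply/matrixP => l k; rewrite !mxE (raddf_sum (mderiv k)) raddf_sum /=.
  apply: eq_bigr => a _.
  by rewrite mderiv_mulC mevalM mevalC mulrC; congr (_ * _); rewrite mxE.
exists c => // x cx; apply: sub_finite_set (cP x cx) => y /= fy j.
rewrite /g !raddf_sum /=; apply: eq_bigr => a _.
by rewrite !mevalM !mevalC fy.
Qed.

End JacobianCriterion.

(** * Vertex functions that change sign along every edge *)

Lemma alternating_connect (T : finType) (R : pzRingType) (e : rel T)
    (y : T -> R) (ye : forall u v, e u v -> y u + y v = 0) (u v : T) :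
  connect e u v -> y v = 0 -> y u = 0.
Proof.
case/connectP => p ep ->; elim: p u ep => //= w p IH u /andP[uw ep] yw.
by have := ye _ _ uw; rewrite (IH w ep yw) addr0.
Qed.

Lemma alternating_path (T : eqType) (R : pzRingType) (e : rel T)
    (y : T -> R) (ye : forall u v, e u v -> y u + y v = 0) (u : T)
    (p : seq T) :
  path e u p -> y (last u p) = (-1) ^+ size p * y u.
Proof.
elim: p u => [|w p IH] u /=; first by rewrite mul1r.
case/andP=> uw /IH ->; rewrite exprSr -mulrA mulN1r; congr (_ * _).
by apply/eqP; rewrite -addr_eq0 addrC ye.
Qed.

(** A function that changes sign along every edge also changes sign along a walk
    of odd length.  It therefore vanishes at the start of an odd cycle, and the
    vanishing spreads over the component. *)
Lemma alternating_eq0 (T : finType) (R : numDomainType) (e : rel T)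
    (y : T -> R) :
  (forall C, C \in components e -> contains_odd_cycle e C) ->
  (forall u v, e u v -> y u + y v = 0) -> forall v, y v = 0.
Proof.
move=> hodd ye v; pose C := [set w in [set: T]%SET | connect e v w].
have CE : C \in components e by apply/imsetP; exists v; rewrite ?inE.
have [[|x p] [[cyc _ _ odd_c] cC]] := hodd C CE; first by [].
have := cC x (mem_head _ _); rewrite !inE /= => vx.
apply: (alternating_connect ye vx).
have := alternating_path ye cyc; rewrite last_rcons size_rcons -signr_odd odd_c.
by rewrite expr1 mulN1r => /eqP; rewrite -addr_eq0 -mulr2n mulrn_eq0 => /eqP.
Qed.

(** * The model in coordinates *)

Section Coordinates.
Variables (m : nat) (E : rel 'I_m).

(** The three components of [of_coords], over an arbitrary ring: applied to the
    vector of the indeterminates, they give the generic member of the model, and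
    evaluating or differentiating them there amounts to doing so on that vector
    ([map_coord_edge_matrix] and its companions). *)
Definition coord_edge_matrix (A : pzRingType) (x : 'rV[A]_(dim_Theta E)) :
    'M[A]_m :=
  \sum_(k < #|edges E|) lsubmx x 0 k *: delta_mx (enum_val k).1 (enum_val k).2.

Definition coord_variances (A : pzRingType) (x : 'rV[A]_(dim_Theta E)) :
    'M[A]_m :=
  diag_mx (lsubmx (rsubmx x)).

Definition coord_loadings (A : pzRingType) (x : 'rV[A]_(dim_Theta E)) :
    'cV[A]_m :=
  (rsubmx (rsubmx x))^T.

Lemma map_coord_edge_matrix (A B : pzRingType) (f : {additive A -> B}) x :
  map_mx f (coord_edge_matrix x) = coord_edge_matrix (map_mx f x).
Proof.
apply/matrixP => i j; rewrite !mxE !summxE raddf_sum; apply: eq_bigr => k _.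
by rewrite !mxE !mulr_natr raddfMn.
Qed.

Lemma map_coord_variances (A B : pzRingType) (f : {additive A -> B}) x :
  map_mx f (coord_variances x) = coord_variances (map_mx f x).
Proof. by apply/matrixP => i j; rewrite !mxE raddfMn. Qed.

Lemma map_coord_loadings (A B : pzRingType) (f : A -> B) x :
  map_mx f (coord_loadings x) = coord_loadings (map_mx f x).
Proof. by apply/matrixP => i j; rewrite !mxE. Qed.

Lemma map_congruence (A B : pzRingType) (f : {rmorphism A -> B}) k l
    (P : 'M[A]_(k, l)) (S : 'M[A]_k) :
  map_mx f (P^T *m S *m P) = (map_mx f P)^T *m map_mx f S *m map_mx f P.
Proof. by rewrite !map_mxM map_trmx. Qed.

Lemma map_gram (A B : pzRingType) (f : {rmorphism A -> B}) k l
    (d : 'M[A]_(k, l)) :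
  map_mx f (d *m d^T) = map_mx f d *m (map_mx f d)^T.
Proof. by rewrite !map_mxM map_trmx. Qed.

Lemma coord_edge_matrix_off (A : pzRingType) (x : 'rV[A]_(dim_Theta E)) w v :
  ~~ E w v -> coord_edge_matrix x w v = 0.
Proof.
move=> nE; rewrite summxE big1 // => k _; rewrite !mxE.
have [/= wk|_] := eqVneq w (enum_val k).1; last by rewrite mulr0.
have [/= vk|_] := eqVneq v (enum_val k).2; last by rewrite mulr0.
by have := enum_valP k; rewrite inE -wk -vk (negPf nE).
Qed.

Lemma unitmx_unitriangular (A : comUnitRingType) (L : 'M[A]_m) :
  topologically_ordered E -> (forall w v, ~~ E w v -> L w v = 0) ->
  1%:M - L \in unitmx.
Proof.
move=> EP LE.
have L0 (i j : 'I_m) : (j <= i)%N -> L i j = 0.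
  by move=> ji; apply: LE; apply/negP => /EP; rewrite ltnNge ji.
rewrite -unitmx_tr unitmxE det_trig.
  by rewrite big1 ?unitr1 // => i _; rewrite !mxE eqxx L0 // subr0.
apply/is_trig_mxP => i j ij; rewrite !mxE L0 ?(ltnW ij) // subr0.
by rewrite -val_eqE /= gtn_eqF.
Qed.

End Coordinates.

Section Model.
Variables (R : realType) (m : nat) (E : rel 'I_m).
Hypothesis hE : topologically_ordered E.
Local Notation n := (dim_Theta E).
Local Notation ev x := (meval (fun i => (x : 'rV[R]_n) 0 i)).

Definition generic_point : 'rV[{mpoly R[n]}]_n := \row_i 'X_i.

(** The matrix I - Lambda of the structural equations. *)
Definition structural_mx : 'M[{mpoly R[n]}]_m :=
  1%:M - coord_edge_matrix generic_point.

Definition generic_error_cov : 'M[{mpoly R[n]}]_m :=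
  coord_variances generic_point +
  coord_loadings generic_point *m (coord_loadings generic_point)^T.

Definition generic_cov : 'M[{mpoly R[n]}]_m :=
  invmx structural_mx^T *m generic_error_cov *m invmx structural_mx.

(** This form without inverses is the one to evaluate and to differentiate. *)
Lemma generic_covE :
  structural_mx^T *m generic_cov *m structural_mx = generic_error_cov.
Proof.
have u : structural_mx \in unitmx.
  apply: (unitmx_unitriangular hE) => w v; exact: coord_edge_matrix_off.
by rewrite /generic_cov !mulmxA mulmxV ?unitmx_tr // mul1mx mulmxKV.
Qed.

Lemma eval_generic_point x : map_mx (ev x) generic_point = x.
Proof. by apply/rowP => i; rewrite !mxE mevalXU. Qed.

Lemma eval_structural_mx x :
  map_mx (ev x) structural_mx = 1%:M - coord_edge_matrix x.
Proof.
by rewrite map_mxB map_mx1 map_coord_edge_matrix eval_generic_point.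
Qed.

Lemma eval_generic_covE x :
  (1%:M - coord_edge_matrix x)^T *m map_mx (ev x) generic_cov *m
    (1%:M - coord_edge_matrix x) =
  coord_variances x + coord_loadings x *m (coord_loadings x)^T.
Proof.
rewrite -eval_structural_mx -map_congruence generic_covE map_mxD map_gram.
by rewrite map_coord_variances map_coord_loadings eval_generic_point.
Qed.

Lemma eval_generic_cov x : map_mx (ev x) generic_cov = phi (of_coords x).
Proof.
have uL : 1%:M - coord_edge_matrix x \in unitmx.
  apply: (unitmx_unitriangular hE) => w v; exact: coord_edge_matrix_off.
rewrite /phi /of_coords -/(coord_edge_matrix x) -/(coord_variances x)
  -/(coord_loadings x) -eval_generic_covE.
have -> : 1%:M - (coord_edge_matrix x)^T = (1%:M - coord_edge_matrix x)^T.
  by rewrite linearB /= trmx1.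
by rewrite -!mulmxA mulKmx ?unitmx_tr // mulmxV // mulmx1.
Qed.

(** The point Lambda = 0, Omega = I, delta = (1, ..., 1). *)
Definition base_point : 'rV[R]_n := row_mx 0 (const_mx 1).

Lemma base_edge_matrix : coord_edge_matrix base_point = 0.
Proof.
by apply: big1 => k _; rewrite row_mxKl mxE scale0r.
Qed.

Lemma base_variances : coord_variances base_point = 1%:M.
Proof.
by apply/matrixP => i j; rewrite /coord_variances row_mxKr !mxE.
Qed.

Lemma base_loadings : coord_loadings base_point = const_mx 1.
Proof. by apply/matrixP => i j; rewrite /coord_loadings row_mxKr !mxE. Qed.

(** * Injectivity of the differential *)

Section Differential.
Variables (x0 v : 'rV[R]_n).

Definition differential (p : {mpoly R[n]}) : R :=
  \sum_k v 0 k * (p^`M(k)).@[fun i => x0 0 i].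

Lemma differential_is_additive : additive differential.
Proof.
move=> p q; rewrite /differential -sumrB; apply: eq_bigr => k _.
by rewrite mderivB mevalB mulrBr.
Qed.
HB.instance Definition _ := GRing.isAdditive.Build {mpoly R[n]} R
  differential differential_is_additive.

Lemma differentialM p q : differential (p * q) =
  differential p * q.@[fun i => x0 0 i] + p.@[fun i => x0 0 i] * differential q.
Proof.
rewrite /differential mulr_suml mulr_sumr -big_split; apply: eq_bigr => k _ /=.
by rewrite mderivM mevalD !mevalM mulrDr mulrA mulrCA.
Qed.

Lemma differential_generic_point : map_mx differential generic_point = v.
Proof.
apply/rowP => i; rewrite !mxE /differential (bigD1 i) //= big1 => [|k ki].
  rewrite mderivX mnm1E eqxx -{1}[U_(i)%MM]add0m addmK mpolyX0 scale1r meval1.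
  by rewrite mulr1 addr0.
by rewrite mderivX mnm1E eq_sym (negPf ki) scale0r meval0 mulr0.
Qed.

Lemma map_differentialM a b c (M : 'M_(a, b)) (N : 'M_(b, c)) :
  map_mx differential (M *m N) =
  map_mx differential M *m map_mx (ev x0) N +
  map_mx (ev x0) M *m map_mx differential N.
Proof.
apply/matrixP => i j; rewrite !mxE raddf_sum -big_split.
apply: eq_bigr => k _ /=.
by rewrite !mxE differentialM.
Qed.

Lemma differential_congruence k l (P : 'M_(k, l)) (S : 'M_k) :
  map_mx differential (P^T *m S *m P) =
  (map_mx differential P)^T *m map_mx (ev x0) S *m map_mx (ev x0) P +
  (map_mx (ev x0) P)^T *m map_mx differential S *m map_mx (ev x0) P +
  (map_mx (ev x0) P)^T *m map_mx (ev x0) S *m map_mx differential P.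
Proof. by rewrite !map_differentialM map_mxM mulmxDl !map_trmx. Qed.

Lemma differential_gram k l (d : 'M_(k, l)) :
  map_mx differential (d *m d^T) =
  map_mx differential d *m (map_mx (ev x0) d)^T +
  map_mx (ev x0) d *m (map_mx differential d)^T.
Proof. by rewrite map_differentialM !map_trmx. Qed.

Lemma differential_structural_mx :
  map_mx differential structural_mx = - coord_edge_matrix v.
Proof.
rewrite map_mxB map_coord_edge_matrix differential_generic_point.
rewrite -[RHS]add0r; congr (_ - _); apply/matrixP => i j; rewrite !mxE.
rewrite raddfMn /= [differential 1]big1 ?mul0rn // => k _.
by rewrite -mpolyC1 mderivC meval0 mulr0.
Qed.

End Differential.

(** At the base point the covariance is I + J with J the all-ones matrix, and
    the differentiated [generic_covE] is linear in the direction [(L, W, d)].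
    The products with J only contribute the column sums of [L], and [y] collects
    these together with [d]. *)
Lemma differential_cov_inj (v : 'rV[R]_n) :
  (forall C, C \in components (complement_graph E) ->
     contains_odd_cycle (complement_graph E) C) ->
  map_mx (differential base_point v) generic_cov = 0 -> v = 0.
Proof.
move=> hodd dcov.
pose L := coord_edge_matrix v; pose W := coord_variances v.
pose d := coord_loadings v.
have := congr1 (map_mx (differential base_point v)) generic_covE.
rewrite differential_congruence dcov mulmx0 mul0mx addr0.
rewrite differential_structural_mx eval_structural_mx base_edge_matrix.
rewrite subr0 trmx1 mul1mx !mulmx1 map_mxD differential_gram.
rewrite map_coord_variances !map_coord_loadings differential_generic_point.
rewrite eval_generic_point base_loadings.
have -> : map_mx (ev base_point) generic_cov = 1%:M + const_mx 1.
  have := eval_generic_covE base_point.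
  rewrite base_edge_matrix base_variances base_loadings subr0 trmx1 mul1mx.
  rewrite mulmx1 => ->; congr (_ + _); apply/matrixP => i j.
  by rewrite !mxE big_ord1 !mxE mulr1.
rewrite -/L -/W -/d mulmxDr mulmxDl mulmx1 mul1mx => eqM.
pose y i := \sum_u L u i + d i 0.
have eqE i j : L i j + L j i + y i + y j + W i j = 0.
  have /matrixP/(_ i j) := eqM; rewrite !mxE !big_ord1 !mxE /y.
  under eq_bigr do rewrite !mxE mulr1.
  under [X in _ + (_ + X)]eq_bigr do rewrite !mxE mul1r.
  rewrite !sumrN => eij.
  have dE k : d k 0 = v ord0 (rshift #|edges E| (rshift m k)).
    by rewrite !mxE.
  move: eij; rewrite !dE; lra.
have L0 i j : ~~ E i j -> L i j = 0 by apply: coord_edge_matrix_off.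
have W0 i j : i != j -> W i j = 0.
  by move=> ij; rewrite !mxE (negPf ij).
(* on a pair adjacent in the complement graph, L and W vanish *)
have y0 : forall i, y i = 0.
  apply: (alternating_eq0 hodd) => i j /and3P[ij nij nji].
  by have := eqE i j; rewrite !L0 // W0 // addr0 !add0r.
have Lz : L = 0.
  apply/matrixP => i j; rewrite mxE.
  have [/hE ij|/L0//] := boolP (E i j).
  have := eqE i j; rewrite !y0 !addr0 (L0 j i) ?W0 ?addr0 //.
    by rewrite -val_eqE /= ltn_eqF.
  by apply/negP => /hE ji; rewrite ltnNge ltnW in ij.
have dz : d = 0.
  apply/matrixP => i j; rewrite ord1; have := y0 i.
  rewrite /y Lz big1 ?add0r => [->|u _]; by rewrite mxE.
have Wz : W = 0.
  apply/matrixP => i j; have := eqE i j.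
  by rewrite !y0 Lz !mxE !addr0 add0r.
apply: of_coords_inj.
rewrite /of_coords -/(coord_edge_matrix v) -/(coord_variances v)
  -/(coord_loadings v) -/L -/W -/d Lz Wz dz.
congr (_, _, _).
- by rewrite big1 // => k _; rewrite !mxE scale0r.
- by apply/matrixP => i j; rewrite !mxE mul0rn.
- by apply/matrixP => i j; rewrite !mxE.
Qed.

End Model.

Theorem theorem1p3 (R : realType) (m : nat) (E : rel 'I_m)
    (hE : topologically_ordered E)
    (hodd : forall C : {set 'I_m}, C \in components (complement_graph E) ->
      contains_odd_cycle (complement_graph E) C) :
  generically_finitely_identifiable R E.
Proof.
pose f (a : 'I_m * 'I_m) := generic_cov R E a.1 a.2.
have [v df|c c0 cP] := @generic_finite_fibers R _ _ f (base_point R E).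
  apply: (differential_cov_inj hE hodd); apply/matrixP => i j.
  by rewrite [LHS]mxE [RHS]mxE; apply: (df (i, j)).
exists (zero_locus [:: c]); split; first by exists [:: c].
- have [x cx] := mpoly_nonvanishing c0.
  move/seteqP => [_ /(_ (\row_i x i) I) /= /(_ c (mem_head _ _)) cx0].
  by case/eqP: cx; rewrite -[RHS]cx0; apply: meval_eq => i; rewrite mxE.
move=> x _ /= nx; have {}nx : c.@[fun i => x 0 i] != 0.
  by apply/eqP => cx; apply: nx => p; rewrite inE => /eqP ->.
apply: sub_finite_set (cP x nx) => y [_ fy] [i j].
have /matrixP/(_ i j) : map_mx (meval (fun i => y 0 i)) (generic_cov R E) =
    map_mx (meval (fun i => x 0 i)) (generic_cov R E).
  by rewrite !(eval_generic_cov hE).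
by rewrite [LHS]mxE [RHS]mxE.
Qed.
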